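(* Let $K$ be an algebraically closed exponential field of characteristic $0$ with standard periods, whose exponential is surjective onto $K^{\times}$. Let $f$ be a simple exponential polynomial over $K$, and let $g$ be an arbitrary exponential polynomial over $K$ such that $f$ and $g$ have infinitely many common roots in $K$. Then there exists an exponential polynomial over $K$ which divides both $f$ and $g$ in the ring $\mathcal{E}$ of exponential polynomials over $K$.
   Context: An exponential field is a field $K$ with a group homomorphism $z\mapsto e^z$ from $(K,+)$ to $(K^{\times},\cdot)$. It has standard periods if the kernel of this homomorphism is an infinite cyclic group. $\mathcal{E}$ is the ring of functions $K\to K$ of the form $z\mapsto \lambda_1 e^{\mu_1 z} + \ldots + \lambda_N e^{\mu_N z}$ with $\lambda_i,\mu_i\in K$ (exponential polynomials), under pointwise addition and multiplication; one writes such a function with the $\mu_i$ distinct and the $\lambda_i$ nonzero unless it is the zero function. The support $supp(f)$ of $f=\sum_{i=1}^N\lambda_i e^{\mu_i z}$ (so written) is the $\mathbb{Q}$-subspace of $K$ generated by $\mu_1,\ldots,\mu_N$. The exponential polynomial $f$ is simple if $\dim_{\mathbb{Q}} supp(f)=1$. *)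

(* Defs.v *)
From HB Require Import structures.
From mathcomp Require Import all_boot all_order all_algebra.
From mathcomp Require Import all_classical.
Set Implicit Arguments.
Unset Strict Implicit.
Unset Printing Implicit Defensive.
Import GRing.Theory.
Local Open Scope classical_set_scope.
Local Open Scope ring_scope.

Section ExponentialPolynomials.
Variable K : fieldType.

Definition exponential (e : K -> K) : Prop :=
  (forall z, e z != 0) /\ (forall x y, e (x + y) = e x * e y).

Definition exp_kernel (e : K -> K) : set K := [set z | e z = 1].

Definition standard_periods (e : K -> K) : Prop :=
  infinite_set (exp_kernel e) /\
  exists w : K, exp_kernel e = range (fun k : int => w *~ k).

Definition surjective_on_units (e : K -> K) : Prop :=
  forall y : K, y != 0 -> exists x : K, e x = y.

(* A sequence of pairs (lambda, mu) encodes the function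
   z |-> sum of the lambda * e^(mu z). *)
Definition exp_sum (e : K -> K) (s : seq (K * K)) : K -> K :=
  fun z => \sum_(p <- s) p.1 * e (p.2 * z).

Definition exp_poly (e : K -> K) : set (K -> K) := range (exp_sum e).

(* The zero function is reduced by the empty sequence. *)
Definition reduced (s : seq (K * K)) : bool :=
  uniq (unzip2 s) && all (fun p => p.1 != 0) s.

Definition divides_exp_poly (e : K -> K) (h f : K -> K) : Prop :=
  exists2 q, exp_poly e q & f = h \* q.

(* [ratr] is the embedding of the rationals only when K has characteristic 0,
   which is assumed wherever the notions below are used. *)
Definition Qspan (m : seq K) : set K :=
  [set x | exists c : 'I_(size m) -> rat, x = \sum_i ratr (c i) * m`_i].

Definition Qfree (m : seq K) : Prop :=
  forall c : 'I_(size m) -> rat,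
    \sum_i ratr (c i) * m`_i = 0 -> forall i, c i = 0.

Definition Qdim (V : set K) (n : nat) : Prop :=
  exists b : seq K, [/\ size b = n, Qfree b & V = Qspan b].

(* If e is not constantly 1 (in particular if e has standard periods and K has
   characteristic 0), distinct mu give distinct characters z |-> e (mu * z), so
   the reduced writing s of f is unique up to order and the support is the span
   of its exponents. *)
Definition supp (e : K -> K) (f : K -> K) : set K :=
  [set x | exists s, [/\ reduced s, f = exp_sum e s & Qspan (unzip2 s) x]].

Definition simple_exp_poly (e : K -> K) (f : K -> K) : Prop :=
  exp_poly e f /\ Qdim (supp e f) 1.

End ExponentialPolynomials.

(* Main.v *)
Require Import Defs.
From HB Require Import structures.
From mathcomp Require Import all_boot all_order all_algebra.
From mathcomp Require Import all_classical.
From mathcomp Require Import zify ring.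
Set Implicit Arguments.
Unset Strict Implicit.
Unset Printing Implicit Defensive.
Import GRing.Theory.
Local Open Scope classical_set_scope.
Local Open Scope ring_scope.

(* A simple f has the form e^(mu z) P(e^(b z)), so some root r of P gives
   infinitely many common zeros with e^(b z) = r; these are z0 + k w / b, with w
   a generator of the kernel. Along them g is an exponential sum in the integer
   k, and by Skolem-Mahler-Lech it vanishes on a progression k in n0 + d N. Then
   h(z) = e^(b z / d) - e^(b z1 / d), with z1 = z0 + n0 w / b, divides both f
   and g.

   Skolem-Mahler-Lech over a field of characteristic 0 follows Hansel: if
   c^d = 1 + p b for all bases c, then n |-> sum of a c^(r + d n) agrees on any
   initial segment with a polynomial whose coefficients of large index are
   highly divisible by p; dividing by (n - t) for each known zero t shows that
   every value is infinitely p-divisible, hence 0. Instead of embedding into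
   Q_p, the ring where this takes place is built inside the field, adjoining
   one generator at a time: an algebraic t is adjoined through its minimal
   polynomial, a transcendental t = a + p y through y. *)

(** * Subrings given by predicates, and monic division over a subring *)

Lemma subring_of_set (R : pzRingType) (A : set R) :
    A 1 -> (forall x y, A x -> A y -> A (x - y)) ->
    (forall x y, A x -> A y -> A (x * y)) ->
  exists S : subringClosed R, forall x, (x \in S) <-> A x.
Proof.
move=> A1 AB AM.
have cl : subring_closed (fun x => `[< A x >]).
  split=> [|x y /asboolP Ax /asboolP Ay|x y /asboolP Ax /asboolP Ay].
  - exact/asboolP.
  - exact/asboolP/AB.
  - exact/asboolP/AM.
pose M := GRing.isSubringClosed.Build R (fun x => `[< A x >]) cl.
pose S : subringClosed R := HB.pack (fun x => `[< A x >]) M.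
by exists S => x; split=> /asboolP.
Qed.

Lemma divring_of_set (K : fieldType) (A : set K) :
    A 1 -> (forall x y, A x -> A y -> A (x - y)) ->
    (forall x y, A x -> A y -> A (x / y)) ->
  exists S : divringClosed K, forall x, (x \in S) <-> A x.
Proof.
move=> A1 AB AM.
have cl : divring_closed (fun x => `[< A x >]).
  split=> [|x y /asboolP Ax /asboolP Ay|x y /asboolP Ax /asboolP Ay].
  - exact/asboolP.
  - exact/asboolP/AB.
  - exact/asboolP/AM.
pose M := GRing.isDivringClosed.Build K (fun x => `[< A x >]) cl.
pose S : divringClosed K := HB.pack (fun x => `[< A x >]) M.
by exists S => x; split=> /asboolP.
Qed.

Section PolyOver.
Variables (R : comNzRingType) (S : subringClosed R).

(** Long division: as D is monic, each step only multiplies and subtracts coefficients, so quotient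
    and remainder stay over S. *)
Lemma monic_division (D P : {poly R}) : D \is monic ->
    D \is a polyOver S -> P \is a polyOver S ->
  exists Q T, [/\ Q \is a polyOver S, T \is a polyOver S, P = Q * D + T
    & (size T < size D)%N].
Proof.
move=> mD DS; have D0 : (0 < size D)%N by rewrite size_poly_gt0 monic_neq0.
have [n] := ubnP (size P); elim: n P => // n IHn P szP PS.
have [lt|ge] := ltnP (size P) (size D).
  by exists 0, P; rewrite mul0r add0r rpred0.
have P0 : (0 < size P)%N by apply: leq_trans ge.
pose c := lead_coef P *: 'X^(size P - size D).
have cS : c \is a polyOver S by rewrite polyOverZ ?polyOverXn ?(polyOverP PS).
have [||Q [T [QS TS eQ sT]]] := IHn (P - c * D).
- apply: (leq_trans _ (ltnSE szP)).
  have [-> |nz] := eqVneq (P - c * D) 0; first by rewrite size_poly0.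
  have le : (size (P - c * D)%R <= size P)%N.
    rewrite (leq_trans (size_polyD _ _)) // geq_max leqnn size_polyN.
    rewrite -scalerAl (leq_trans (size_scale_leq _ _)) //.
    by rewrite size_monicM ?monicXn ?monic_neq0 // size_polyXn addSn /= subnK.
  rewrite ltn_neqAle le andbT; apply: contra_neq nz => sz.
  apply/eqP; rewrite -lead_coef_eq0 lead_coefE sz coefB /c -scalerAl coefZ.
  rewrite coefXnM ifF; last by lia.
  have -> : ((size P).-1 - (size P - size D) = (size D).-1)%N by lia.
  by rewrite -!lead_coefE (monicP mD) mulr1 subrr.
- by rewrite rpredB ?rpredM.
exists (c + Q), T; split=> //; first exact: rpredD.
by rewrite mulrDl -addrA -eQ addrC subrK.
Qed.
End PolyOver.

(** * Hansel's zero estimate *)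

(** Legendre's formula: with y = n %/ p, the valuation of n! is y plus that of y!, and (p - 1) y + y
    = p y <= n. *)
Lemma logn_fact_le p n : prime p -> ((p - 1) * logn p n`! <= n)%N.
Proof.
move=> pp; have p1 := prime_gt1 pp; rewrite logn_fact //.
move: n.+1 => m; elim: m n => [|m IHm] n; first by rewrite big_geq // muln0.
case: m IHm => [|m] IHm; first by rewrite big_geq // muln0.
rewrite big_nat_recl // expn1.
under eq_bigr do rewrite expnS divnMA.
have := IHm (n %/ p)%N; have := leq_divM n p.
move: (n %/ p)%N => y; move: (\sum_(_ <= _ < _) _)%N => x; nia.
Qed.

(* The subring A only serves to have S finite modulo p on a ring containing the
   given elements: a unit of A then has a power congruent to 1 modulo p S. *)
Record padic_model (K : fieldType) (p : nat) (S A : subringClosed K) : Prop :=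
  PadicModel {
  model_prime : prime p;
  model_odd : (2 < p)%N;
  model_sub : {subset A <= S};
  model_inv : forall m : nat, coprime p m -> m%:R^-1 \in S;
  model_sep : forall x : K,
    (forall k, exists2 s, s \in S & x = p%:R ^+ k * s) -> x = 0;
  model_fin : exists r : seq K, forall a, a \in A ->
    exists2 b, b \in r & exists2 s, s \in S & a - b = p%:R * s }.

Section Hansel.
Variable K : fieldType.
Hypothesis natr_eq0 : forall n : nat, (n%:R == 0 :> K) = (n == 0%N).

Lemma natr_inj : injective (fun n : nat => n%:R : K).
Proof.
move=> m n /= eq; wlog le: m n eq / (m <= n)%N.
  by case/orP: (leq_total m n) => le hw; [exact: hw | apply/esym/hw].
by apply/eqP; rewrite eqn_leq le -subn_eq0 -natr_eq0 natrB // eq subrr eqxx.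
Qed.

(** If g = (X - t) R, then R_i = g_(i+1) + t R_(i+1), so each zero divided out lowers by one the
    index from which the coefficients lie in S. At the end the quotient is over S, and the removed
    factors n - t are integers. *)
Lemma horner_sub_of_zeros (S : subringClosed K) (g : {poly K}) (ts : seq nat) :
    uniq ts -> (forall t, t \in ts -> g.[t%:R] = 0) ->
    (forall i, (size ts <= i)%N -> g`_i \in S) ->
  forall n : nat, g.[n%:R] \in S.
Proof.
elim: ts g => [|t ts IHts] g /=.
  move=> _ _ gS n; apply: rpred_horner; last exact: rpred_nat.
  by apply/polyOverP => i; apply: gS.
move=> /andP[t_ts uts] g0 gS n.
have /factor_theorem[R eR] : root g t%:R by apply/rootP/g0; rewrite mem_head.
rewrite eR hornerM rpredM //; last by rewrite hornerXsubC rpredB ?rpred_nat.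
apply: IHts => // [s s_ts | i le].
  have /eqP := g0 s (mem_behead (s := t :: ts) s_ts).
  rewrite eR hornerM mulf_eq0 hornerXsubC subr_eq0 =>
    /orP[/eqP //|/eqP/natr_inj].
  by move=> st; rewrite -st s_ts in t_ts.
(* Descending induction on i, from where the coefficients of R vanish. *)
have [d] := ubnP (size R - i); elim: d i le => // d IHd i le szd.
have [leR|ltR] := leqP (size R) i; first by rewrite nth_default ?rpred0.
have -> : R`_i = g`_i.+1 + t%:R * R`_i.+1.
  by rewrite eR mulrBr coefB coefMX /= [R * _]mulrC coefCM subrK.
rewrite rpredD ?gS // rpredM ?rpred_nat // IHd //; last by lia.
exact: leqW.
Qed.

Definition falling i : {poly K} := \prod_(j < i) ('X - j%:R%:P).

Lemma size_falling i : size (falling i) = i.+1.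
Proof. by rewrite size_prod_XsubC /= /index_enum -enumT size_enum_ord. Qed.

Lemma horner_falling i n : (falling i).[n%:R] = (i`!)%:R * 'C(n, i)%:R.
Proof.
rewrite -natrM mulnC bin_ffact horner_prod ffact_prod natr_prod.
have [le|lt] := leqP i n.
  apply: eq_bigr => j _; rewrite hornerXsubC natrB //.
  by rewrite (leq_trans (ltnW (ltn_ord j))).
rewrite (bigD1 (Ordinal lt)) //= hornerXsubC subrr mul0r.
by rewrite (bigD1 (Ordinal lt)) //= subnn mul0r.
Qed.

(** The valuation of i! is at most i / (p - 1) <= i / 2 because p > 2, so p^i / i! keeps a factor
    p^k. The part of i! prime to p is inverted by [model_inv]. *)
Lemma model_pow_fact p (S A : subringClosed K) i k :
  padic_model p S A -> (k.*2 <= i)%N ->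
  p%:R ^- k * (p%:R ^+ i / (i`!)%:R) \in S.
Proof.
move=> M le; have pp := model_prime M.
have p0 : p%:R != 0 :> K by rewrite natr_eq0 -lt0n prime_gt0.
have := pfactor_coprime pp (fact_gt0 i); case=> w cpw ->.
have vle := logn_fact_le i pp; have podd := model_odd M.
set v := logn p i`! in vle *.
have kv : (k + v <= i)%N by nia.
rewrite natrM natrX -(subnKC kv) !exprD invfM.
have -> : p%:R ^- k * (p%:R ^+ k * p%:R ^+ v * p%:R ^+ (i - (k + v)) *
    (w%:R^-1 / p%:R ^+ v)) = p%:R ^+ (i - (k + v)) * w%:R^-1 :> K.
  have w0 : w%:R != 0 :> K.
    rewrite natr_eq0; apply: contraTneq cpw => ->.
    by rewrite /coprime gcdn0; lia.
  by field; rewrite w0 !expf_neq0.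
by rewrite rpredM ?rpredX ?rpred_nat // (model_inv M).
Qed.

Lemma infinite_nat_seq (Z : set nat) k : infinite_set Z ->
  exists ts : seq nat, [/\ uniq ts, size ts = k & forall t, t \in ts -> Z t].
Proof.
move=> /infiniteP/pcard_leP[f].
exists [seq f i | i <- iota 0 k]; split=> [||t /mapP[i _ ->]].
- by rewrite map_inj_uniq ?iota_uniq // => i j /inj; rewrite !inE => ->.
- by rewrite size_map size_iota.
- exact: funS.
Qed.

Lemma exp_sum_zero_of_model p (S A : subringClosed K) (s : seq (K * K)) :
  padic_model p S A ->
    (forall x, x \in s -> x.1 \in S /\ x.2 \in S) ->
    infinite_set
      [set n : nat | \sum_(x <- s) x.1 * (1 + p%:R * x.2) ^+ n = 0] ->
  forall n : nat, \sum_(x <- s) x.1 * (1 + p%:R * x.2) ^+ n = 0.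
Proof.
pose u (n : nat) := \sum_(x <- s) x.1 * (1 + p%:R * x.2) ^+ n.
move=> M sS inf n; rewrite -/(u n).
(* For each k, p^(-k) u(n) is shown to lie in S by means of 2k known zeros. *)
apply: (model_sep M) => k.
have p0 : p%:R != 0 :> K by rewrite natr_eq0 -lt0n prime_gt0 ?(model_prime M).
have [ts [uts szts ts0]] := infinite_nat_seq k.*2 inf.
have {}ts0 t : t \in ts -> u t = 0 by move/ts0.
(* L exceeds n and the chosen zeros, so the binomial expansion cut at L is exact at all of them. *)
pose L := (\max_(t <- n :: ts) t).+1.
have ltL t : t \in n :: ts -> (t < L)%N by move=> ?;
  rewrite ltnS leq_bigmax_seq.
pose a i := \sum_(x <- s) x.1 * x.2 ^+ i.
pose g := \sum_(i < L) (p%:R ^+ i * a i / (i`!)%:R) *: falling i.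
have gE m : (m < L)%N -> g.[m%:R] = u m.
  move=> ltm; rewrite horner_sum /u.
  under eq_bigr => i _.
    rewrite hornerZ horner_falling.
    have -> : p%:R ^+ i * a i / (i`!)%:R * ((i`!)%:R * 'C(m, i)%:R)
      = \sum_(x <- s) x.1 * (p%:R * x.2) ^+ i *+ 'C(m, i).
      rewrite mulrA mulfVK ?natr_eq0 -?lt0n ?fact_gt0 //.
      rewrite mulr_sumr mulr_suml; apply: eq_bigr => x _.
      by rewrite exprMn mulr_natr; ring.
    over.
  rewrite exchange_big; apply: eq_bigr => x _ /=.
  rewrite exprDn mulr_sumr (big_ord_widen L (fun i => x.1 *
    (1 ^+ (m - i) * (p%:R * x.2) ^+ i *+ 'C(m, i)))) //.
  rewrite [RHS]big_mkcond; apply: eq_bigr => i _; case: ifP => [_|ge].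
    by rewrite expr1n mul1r mulrnAr.
  by rewrite bin_small ?mulr0n //; lia.
exists (p%:R ^- k * u n); last by rewrite mulrA divff ?mul1r // expf_neq0.
rewrite -gE ?ltL ?mem_head // -hornerZ.
apply: (horner_sub_of_zeros uts) => [t tts | i].
  by rewrite hornerZ gE ?ltL ?in_cons ?tts ?orbT // ts0 ?mulr0.
rewrite szts => le; rewrite coefZ coef_sum mulr_sumr; apply: rpred_sum => j _.
(* Coefficient i of [falling j] vanishes for j < i, so only j >= i >= 2k contribute, where p^j / j!
   is divisible by p^k. *)
rewrite coefZ; have [lt|ge] := ltnP j i.
  by rewrite [_`_i]nth_default ?size_falling // !mulr0 rpred0.
have -> : p%:R ^+ j * a j / (j`!)%:R = p%:R ^+ j / (j`!)%:R * a j by ring.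
rewrite !mulrA -[_ * _ / _]mulrA rpredM //; first rewrite rpredM //.
- by apply: (model_pow_fact M); apply: leq_trans ge.
- by rewrite /a big_seq rpred_sum // => x /sS[? ?]; rewrite rpredM ?rpredX.
- by apply/polyOverP/rpred_prod => l _; rewrite polyOverXsubC rpred_nat.
Qed.
End Hansel.

(** * p-adic models over finitely generated fields *)

Section Adjunction.
Variable K : fieldType.

Lemma subring_adjoin (S : subringClosed K) (t : K) :
  exists S' : subringClosed K,
    forall x, (x \in S') <-> exists2 P, P \is a polyOver S & x = P.[t].
Proof.
apply: subring_of_set => [|x y [P PS ->] [Q QS ->]|x y [P PS ->] [Q QS ->]].
- by exists 1; rewrite ?rpred1 ?hornerC.
- by exists (P - Q); rewrite ?rpredB // hornerD hornerN.
- by exists (P * Q); rewrite ?rpredM // hornerM.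
Qed.

Section AlgebraicModel.
Variables (p : nat) (S A : subringClosed K) (t : K) (M : {poly K}).
Hypothesis model : padic_model p S A.
Hypotheses (monicM : M \is monic) (MA : M \is a polyOver A) (Mt : M.[t] = 0).
Hypothesis indep : forall P, P \is a polyOver S -> (size P < size M)%N ->
  P.[t] = 0 -> P = 0.

(** Each element of S[t] is the value of a unique polynomial over S shorter than M, so divisibility
    by powers of p is read off the coefficients. *)
Lemma model_adjoin_algebraic : exists S' A' : subringClosed K,
  [/\ padic_model p S' A',
      forall x, (x \in S') <-> exists2 P, P \is a polyOver S & x = P.[t] &
      forall x, (x \in A') <-> exists2 P, P \is a polyOver A & x = P.[t]].
Proof.
have [[S' S'P] [A' A'P]] := (subring_adjoin S t, subring_adjoin A t).
exists S', A'; split=> //.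
have SS' x : x \in S -> x \in S'.
  by move=> xS; apply/S'P; exists x%:P; rewrite ?polyOverC ?hornerC.
have tS' : t \in S' by apply/S'P; exists 'X; rewrite ?polyOverX ?hornerX.
have AS := model_sub model.
have reduce (B : subringClosed K) P :
  M \is a polyOver B -> P \is a polyOver B ->
    exists T, [/\ T \is a polyOver B, (size T < size M)%N & T.[t] = P.[t]].
  move=> MB PB; have [Q [T [_ TB -> ltT]]] := monic_division monicM MB PB.
  by exists T; rewrite hornerD hornerM Mt mulr0 add0r.
split=> [||x|m cpm|x div|].
- exact: model_prime model.
- exact: model_odd model.
- by move/A'P=> [P PA ->]; apply/S'P; exists P => //; apply: polyOverS PA.
- exact/SS'/(model_inv model).
- have /choice[T TP] : forall k, exists T, [/\ T \is a polyOver S,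
      (size T < size M)%N & x = p%:R ^+ k * T.[t]].
    move=> k; have [s /S'P[P PS ->] ->] := div k.
    have [|T [TS ltT eT]] := reduce S P _ PS; first exact: polyOverS MA.
    by exists T; rewrite eT.
  have [T0S lt0 ->] := TP 0%N; rewrite expr0 mul1r.
  suff -> : T 0%N = 0 by rewrite horner0.
  apply/polyP=> i; rewrite coef0; apply: (model_sep model) => k.
  have [TkS ltk ek] := TP k; exists (T k)`_i; first exact/polyOverP.
  (* Both polynomials are reduced representatives of x, so [indep] identifies them. *)
  suff /eqP : T 0%N - p%:R ^+ k *: T k = 0.
    by rewrite subr_eq0 => /eqP ->; rewrite coefZ.
  apply: indep.
  + by rewrite rpredB ?polyOverZ ?rpredX ?rpred_nat.
  + rewrite (leq_ltn_trans (size_polyD _ _)) // gtn_max lt0 size_polyN.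
    exact: leq_ltn_trans (size_scale_leq _ _) ltk.
  + by have [_ _ e0] := TP 0%N;
      rewrite hornerD hornerN hornerZ -ek e0 mul1r subrr.
- have [r rP] := model_fin model.
  suff [b bP] : exists b : seq K, forall P, P \is a polyOver A ->
      (size P <= size M)%N -> exists2 c, c \in b &
      exists2 s, s \in S' & P.[t] - c = p%:R * s.
    exists b => x /A'P[P PA ->]; have [T [TA ltT <-]] := reduce A P MA PA.
    exact: bP (ltnW ltT).
  (* Representatives modulo p are built by Horner's scheme: one for the constant coefficient, plus t
     times one for the rest. *)
  elim: (size M) => [|n [b bP]].
    exists [:: 0] => P _ /size_poly_leq0P ->; exists 0; rewrite ?mem_head //.
    by exists 0; rewrite ?rpred0 // horner0 subr0 mulr0.
  exists [seq c + d * t | c <- r, d <- b] => P PA szP.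
  have [|c cr [s sS es]] := rP P`_0; first exact/polyOverP.
  have [||d db [s' sS' es']] := bP (drop_poly 1 P).
  + by apply/polyOverP=> i; rewrite coef_drop_poly; apply/polyOverP.
  + by rewrite size_drop_poly; lia.
  exists (c + d * t); first exact: (allpairs_f (fun c d => c + d * t)).
  exists (s + s' * t); first by rewrite rpredD ?(SS' s) ?rpredM.
  rewrite -[P](poly_take_drop 1) hornerD hornerM hornerXn expr1.
  have -> : (take_poly 1 P).[t] = P`_0.
    by rewrite [take_poly 1 P]size1_polyC ?size_take_poly //
      hornerC coef_take_poly.
  rewrite mulrDr mulrA -es -es'; ring.
Qed.
End AlgebraicModel.

Section TranscendentalModel.
Variables (p : nat) (S A : subringClosed K) (y : K).
Hypothesis model : padic_model p S A.
Hypothesis transc : forall P, P \is a polyOver S -> P.[y] = 0 -> P = 0.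

Let one_add_p (Q : {poly K}) := 1 + p%:R *: Q.

Lemma model_no_inv : ~ (exists2 s, s \in S & 1 = p%:R * s).
Proof.
case=> s sS e; have /eqP := oner_neq0 K; apply; apply: (model_sep model) => k.
by exists (s ^+ k); rewrite ?rpredX // -exprMn -e expr1n.
Qed.

(* Elements of S[X] congruent to 1 mod p are invertible mod p^k, so inverting
   them creates no new p-divisibility. *)
Lemma p_divisible_cancel (P Q R : {poly K}) k :
    P \is a polyOver S -> Q \is a polyOver S -> R \is a polyOver S ->
    P * one_add_p Q = p%:R ^+ k *: R ->
  exists2 T, T \is a polyOver S & P = p%:R ^+ k *: T.
Proof.
move=> PS QS RS e; have pS : p%:R \in S by rewrite rpred_nat.
(* Truncated geometric series: an inverse of 1 + p Q modulo p^k. *)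
pose W := \sum_(i < k) (- (p%:R *: Q)) ^+ i.
have eW : one_add_p Q * W = 1 - p%:R ^+ k *: (- Q) ^+ k.
  have := subrX1 (- (p%:R *: Q)) k; rewrite -/W -scalerN exprZn => h.
  by apply/oppr_inj; rewrite opprB h /one_add_p scalerN; ring.
exists (R * W + P * (- Q) ^+ k).
  by rewrite rpredD ?rpredM ?rpredX ?rpred_sum ?rpredN // => i _;
     rewrite rpredX ?rpredN ?polyOverZ.
rewrite scalerDr scalerAl -e -mulrA eW mulrBr mulr1 scalerAr.
by rewrite subrK.
Qed.

(** Otherwise 1 + p Q is the zero polynomial by transcendence, and its constant coefficient exhibits
    an inverse of p in S. *)
Lemma one_add_p_neq0 Q : Q \is a polyOver S -> (one_add_p Q).[y] != 0.
Proof.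
move=> QS; apply/eqP => /transc e0; apply: model_no_inv.
exists (- Q`_0); first by rewrite rpredN; apply/polyOverP.
have /(congr1 (coefp 0)) : one_add_p Q = 0.
  by apply: e0; rewrite rpredD ?rpred1 ?polyOverZ ?rpred_nat.
by rewrite /= coefD coefC coefZ coef0 mulrN /= => /eqP;
  rewrite addr_eq0 => /eqP.
Qed.

(** [S'] is S[y] with all 1 + p Q(y) inverted, and [A'] is A + p [S'], which contains p y and has no
    residues modulo p beyond those of A. *)
Lemma model_adjoin_transcendental : exists S' A' : subringClosed K,
  [/\ padic_model p S' A',
      forall x, (x \in S') <-> exists P Q,
        [/\ P \is a polyOver S, Q \is a polyOver S &
            x * (1 + p%:R * Q.[y]) = P.[y]] &
      forall x, (x \in A') <-> exists2 a, a \in A &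
        exists2 s, s \in S' & x - a = p%:R * s].
Proof.
have pS : p%:R \in S by rewrite rpred_nat.
have nz Q : Q \is a polyOver S -> 1 + p%:R * Q.[y] != 0.
  by move=> /one_add_p_neq0; rewrite hornerD hornerC hornerZ.
have [|x x' [P [Q [PS QS e]]] [P' [Q' [PS' QS' e']]]
      |x x' [P [Q [PS QS e]]] [P' [Q' [PS' QS' e']]]|S' S'P] :=
    @subring_of_set K [set x | exists P Q,
        [/\ P \is a polyOver S, Q \is a polyOver S &
            x * (1 + p%:R * Q.[y]) = P.[y]]].
- by exists 1, 0; rewrite rpred1 rpred0 horner0 hornerC mulr0 addr0 mulr1.
(* The common denominator is again of the required form: (1 + p Q)(1 + p Q') = 1 + p (Q + Q' + p Q
   Q'). *)
- exists (P * one_add_p Q' - P' * one_add_p Q), (Q + Q' + p%:R *: (Q * Q')).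
  split; rewrite ?(rpredB, rpredD, rpredM, polyOverZ, rpred1) //.
  by rewrite /one_add_p !(hornerD, hornerN, hornerM, hornerZ, hornerC) -e -e';
     ring.
- exists (P * P'), (Q + Q' + p%:R *: (Q * Q')).
  split; rewrite ?(rpredB, rpredD, rpredM, polyOverZ, rpred1) //.
  by rewrite /one_add_p !(hornerD, hornerN, hornerM, hornerZ, hornerC) -e -e';
     ring.
have SS' x : x \in S -> x \in S'.
  move=> xS; apply/S'P; exists x%:P, 0.
  by rewrite polyOverC rpred0 horner0 hornerC mulr0 addr0 mulr1.
have AS := model_sub model.
have [|x x' [a aA [s sS e]] [a' aA' [s' sS' e']]
      |x x' [a aA [s sS e]] [a' aA' [s' sS' e']]|A' A'P] :=
    @subring_of_set K [set x | exists2 a, a \in A &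
        exists2 s, s \in S' & x - a = p%:R * s].
- by exists 1; rewrite ?rpred1 //; exists 0; rewrite ?rpred0 // subrr mulr0.
- exists (a - a'); first exact: rpredB.
  by exists (s - s'); [exact: rpredB | rewrite mulrBr -e -e'; ring].
- exists (a * a'); first exact: rpredM.
  exists (s * a' + a * s' + p%:R * s * s').
    by rewrite ?(rpredD, rpredM) ?rpred_nat ?(SS' a) ?(SS' a') ?AS.
  move/eqP: e; rewrite subr_eq => /eqP ->.
  by move/eqP: e'; rewrite subr_eq => /eqP ->; ring.
exists S', A'; split=> //; split=> [||x|m cpm|x div|].
- exact: model_prime model.
- exact: model_odd model.
- move=> /A'P[a aA [s sS /eqP]]; rewrite subr_eq => /eqP ->.
  by rewrite rpredD ?rpredM ?rpred_nat ?(SS' a) ?AS.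
- exact/SS'/(model_inv model).
- have [s /S'P[P [Q [PS QS e]]]] := div 0%N; rewrite expr0 mul1r => xs.
  rewrite -{}xs in e.
  suff P0 : P = 0.
    by move/eqP: e; rewrite P0 horner0 mulf_eq0 (negPf (nz _ QS)) orbF => /eqP.
  apply/polyP=> i; rewrite coef0; apply: (model_sep model) => k.
  have [s' /S'P[P' [Q' [PS' QS' e']]] xs'] := div k.
  (* Clearing denominators in P / (1 + p Q) = p^k P' / (1 + p Q') gives an identity at y, hence one
     of polynomials by transcendence. *)
  have [||||T TS ->] := @p_divisible_cancel P Q' (P' * one_add_p Q) k => //.
  + by rewrite rpredM // rpredD ?rpred1 ?polyOverZ.
  + apply/eqP; rewrite -subr_eq0; apply/eqP/transc.
      by rewrite ?(rpredB, rpredD, rpredM, polyOverZ, rpred1, rpredX).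
    rewrite /one_add_p !(hornerD, hornerN, hornerM, hornerZ, hornerC) -e -e'
      xs'; ring.
  by exists T`_i; [exact/polyOverP | rewrite coefZ].
- have [r rP] := model_fin model; exists r => x /A'P[a aA [s sS e]].
  have [b br [s' sS' e']] := rP a aA; exists b => //.
  exists (s + s'); first by rewrite rpredD ?(SS' s').
  by rewrite mulrDr -e -e' addrA subrK.
Qed.
End TranscendentalModel.
End Adjunction.

(** * Models over the prime field and their passage to a simple extension *)

Section Tower.
Variable K : fieldType.
Hypothesis natr_eq0 : forall n : nat, (n%:R == 0 :> K) = (n == 0%N).

Lemma intr_eq0_char0 (m : int) : (m%:~R == 0 :> K) = (m == 0).
Proof.
case: m => n; first by rewrite -pmulrn natr_eq0.
by rewrite NegzE mulrNz oppr_eq0 -pmulrn natr_eq0.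
Qed.

Lemma intr_inj_char0 : injective (fun m : int => m%:~R : K).
Proof.
move=> m n /= /eqP; rewrite -subr_eq0 -rmorphB /= intr_eq0_char0 subr_eq0.
by move/eqP.
Qed.

(** The invariant of the tower. Keeping S inside F lets minimality or transcendence over F supply
    the independence over S that adjunction requires. *)
Definition has_models (F : divringClosed K) : Prop :=
  forall l : seq K, {subset l <= F} -> exists p (S A : subringClosed K),
    [/\ padic_model p S A, {subset S <= F} & {subset l <= A}].

Lemma coprime_natr_neq0 p n : (1 < p)%N -> coprime p n -> n%:R != 0 :> K.
Proof.
move=> p1 cpn; rewrite natr_eq0; apply: contraTneq cpn => ->.
by rewrite /coprime gcdn0 neq_ltn p1 orbT.
Qed.

Lemma padic_localization_subring p : exists S : subringClosed K,
  forall x, (x \in S) <->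
    exists (m : int) (n : nat), coprime p n /\ x * n%:R = m%:~R.
Proof.
apply: subring_of_set => [|x y [m [n [cn e]]] [m' [n' [cn' e']]]
  |x y [m [n [cn e]]] [m' [n' [cn' e']]]].
- by exists 1, 1%N; rewrite coprimen1 mulr1.
- exists (m * n'%:Z - m' * n%:Z), (n * n')%N; rewrite coprimeMr cn; split=> //.
  by rewrite natrM rmorphB /= !rmorphM /= -e -e' -!pmulrn; ring.
- exists (m * m'), (n * n')%N; rewrite coprimeMr cn; split=> //.
  by rewrite natrM rmorphM /= -e -e'; ring.
Qed.

Lemma padic_localization_model p (S : subringClosed K) :
    prime p -> (2 < p)%N ->
    (forall x, (x \in S) <->
      exists (m : int) (n : nat), coprime p n /\ x * n%:R = m%:~R) ->
  padic_model p S S.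
Proof.
move=> pp p2 SP; have n0 := coprime_natr_neq0 (prime_gt1 pp).
split=> //.
- move=> m cpm; apply/SP; exists 1, m; split=> //.
  by rewrite mulVf ?n0.
- move=> x div; have [s /SP[m [n [cn e]]]] := div 0%N.
  rewrite expr0 mul1r => xs; rewrite -{}xs in e.
  suff m0 : m = 0.
    by move/eqP: e; rewrite m0 mulf_eq0 (negPf (n0 _ cn)) orbF => /eqP.
  (* The exponent |m| suffices: p^|m| > |m|, so p^|m| divides m only if m = 0. *)
  have [s' /SP[m' [n' [cn' e']]] xs'] := div `|m|%N.
  have em : m * n'%:Z = (p ^ `|m|)%:Z * m' * n%:Z.
    apply: intr_inj_char0; rewrite !rmorphM /= -e -e' xs' -!pmulrn natrX; ring.
  have : (p ^ `|m| %| `|m| * n')%N.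
    rewrite -[n']absz_nat -abszM em !abszM /= -mulnA.
    exact: dvdn_mulr.
  rewrite Gauss_dvdl ?coprimeXl //.
  have [->//|mn0] := eqVneq m 0; move/dvdn_leq.
  rewrite absz_gt0 mn0 => /(_ isT).
  by rewrite leqNgt ltn_expl ?prime_gt1.
- exists [seq j%:R | j <- iota 0 p] => a /SP[m [n [cn e]]].
  (* Bezout makes v an inverse of n modulo p, so j = m v mod p represents m / n. *)
  have /coprimezP[[u v] /= uv] : coprimez p%:Z n%:Z by rewrite coprimezE.
  have p0 : p%:Z != 0 by lia.
  have [j lj ej] : exists2 j : nat, (j < p)%N & j%:Z = ((m * v) %% p)%Z.
    have ge := modz_ge0 (m * v) p0; exists `|((m * v) %% p)%Z|%N.
      by rewrite -ltz_nat gez0_abs // ltz_pmod // ltz_nat prime_gt0.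
    by rewrite gez0_abs.
  exists j%:R; first by apply: map_f; rewrite mem_iota.
  pose t := (m * u + ((m * v) %/ p)%Z * n%:Z).
  exists (t%:~R / n%:R).
    by apply/SP; exists t, n; rewrite mulfVK ?n0.
  have key : m - j%:Z * n%:Z = p%:Z * t.
    have := divz_eq (m * v) p; rewrite -ej /t => dv.
    have -> : j%:Z = m * v - ((m * v) %/ p)%Z * p by rewrite {1}dv; ring.
    by rewrite -{1}[m]mulr1 -uv; ring.
  apply: (mulIf (n0 _ cn)).
  rewrite mulrBl e !mulrA mulfVK ?n0 //.
  by have /(congr1 (fun z : int => z%:~R : K)) := key;
     rewrite rmorphB !rmorphM /= -!pmulrn.
Qed.

(** F is the prime field. The list l involves finitely many denominators, and an odd prime above all
    of them makes every entry p-integral. *)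
Lemma prime_field_has_models : exists F : divringClosed K, has_models F.
Proof.
have [|x y [m [n [n0 e]]] [m' [n' [n0' e']]]
  |x y [m [n [n0 e]]] [m' [n' [n0' e']]]|F FP] := @divring_of_set K
  [set x | exists (m : int) (n : nat), n%:R != 0 :> K /\ x * n%:R = m%:~R].
- by exists 1, 1%N; rewrite oner_neq0 mulr1.
- exists (m * n'%:Z - m' * n%:Z), (n * n')%N; rewrite natrM mulf_neq0 //.
  by split=> //; rewrite rmorphB /= !rmorphM /= -e -e' -!pmulrn; ring.
- have [-> |y0] := eqVneq y 0.
    by exists 0, 1%N; rewrite oner_neq0 invr0 mulr0 mul0r.
  exists (m * n'%:Z * Num.sg m'), (n * `|m'|)%N.
  have m0' : m'%:~R != 0 :> K by rewrite -e' mulf_neq0.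
  have ea : `|m'|%N%:R = m'%:~R * (Num.sg m')%:~R :> K.
    by rewrite pmulrn abszE Num.Theory.normrEsg mulrC rmorphM.
  have s0 : (Num.sg m')%:~R != 0 :> K.
    by move: m0'; rewrite !intr_eq0_char0 Num.Theory.sgr_eq0.
  rewrite natrM ea !mulf_neq0 //; split=> //.
  by rewrite !rmorphM /= -e -e' -!pmulrn; field.
exists F => l lF.
have /choice[d dP] : forall x, exists n : nat, x \in l ->
    (n != 0)%N /\ exists m : int, x * n%:R = m%:~R.
  move=> x; case: (boolP (x \in l)) => [/lF/FP[m [n [n0 e]]]|_];
    last by exists 0%N.
  by exists n => _; rewrite -natr_eq0; split=> //; exists m.
have [p lp pp] := prime_above (maxn 2 (\max_(x <- l) d x)).
move: lp; rewrite gtn_max => /andP[p2 lp].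
have [S SP] := padic_localization_subring p.
exists p, S, S; split.
- exact: padic_localization_model.
- move=> x /SP[m [n [cn e]]]; apply/FP; exists m, n; split=> //.
  exact: coprime_natr_neq0 (prime_gt1 pp) cn.
- move=> x xl; have [d0 [m e]] := dP x xl; apply/SP; exists m, (d x);
    split=> //.
  rewrite prime_coprime // gtnNdvd ?lt0n //.
  by apply: leq_ltn_trans lp; apply: leq_bigmax_seq.
Qed.

Lemma divring_adjoin (F : divringClosed K) (t : K) :
  exists F' : divringClosed K, forall x, (x \in F') <-> exists P D,
    [/\ P \is a polyOver F, D \is a polyOver F, D.[t] != 0 & x = P.[t] / D.[t]].
Proof.
apply: divring_of_set => [|x y [P [D [PF DF D0 ->]]] [P' [D' [PF' DF' D0' ->]]]
  |x y [P [D [PF DF D0 ->]]] [P' [D' [PF' DF' D0' ->]]]].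
- by exists 1, 1; rewrite rpred1 !hornerC oner_neq0 divr1.
- exists (P * D' - P' * D), (D * D').
  rewrite ?(rpredB, rpredM) // !(hornerD, hornerN, hornerM) mulf_neq0 //.
  by split=> //; field; rewrite D0 D0'.
- have [e0|P0'] := eqVneq P'.[t] 0.
    by exists 0, 1; rewrite rpred0 rpred1 !hornerC oner_neq0 e0 mul0r invr0
      mulr0 mul0r.
  exists (P * D'), (D * P').
  rewrite ?rpredM // !hornerM mulf_neq0 //.
  by split=> //; field; rewrite D0 P0' D0'.
Qed.

Section MinimalPolynomial.
Variables (F : divringClosed K) (t : K) (M : {poly K}).
Hypotheses (MF : M \is a polyOver F) (monicM : M \is monic) (Mt : M.[t] = 0).
Hypothesis minM : forall P, P \is a polyOver F -> (size P < size M)%N ->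
  P.[t] = 0 -> P = 0.

(** Euclid's algorithm at t: dividing M by the normalised D leaves R with R(t) a multiple of D(t),
    so an inverse of R(t) gives one of D(t). *)
Lemma adjoin_inverse D : D \is a polyOver F -> D.[t] != 0 ->
  exists2 V, V \is a polyOver F & V.[t] * D.[t] = 1.
Proof.
move=> DF Dt.
wlog ltD : D DF Dt / (size D < size M)%N.
  have [Q [T [_ TF eD ltT]]] := monic_division monicM MF DF.
  have eT : D.[t] = T.[t] by rewrite eD hornerD hornerM Mt mulr0 add0r.
  by move=> /(_ T TF _ ltT); rewrite -eT; apply.
have [n] := ubnP (size D); elim: n D DF Dt ltD => // n IHn D DF Dt ltD szD.
have D0 : D != 0 by apply: contraNneq Dt => ->; rewrite horner0.
have lD0 : lead_coef D != 0 by rewrite lead_coef_eq0.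
have lDF : (lead_coef D)^-1 \in F by rewrite rpredV; apply/polyOverP.
pose D' := (lead_coef D)^-1 *: D.
have sD' : size D' = size D by rewrite size_scale ?invr_eq0.
have mD' : D' \is monic by rewrite monicE lead_coefZ mulVf.
have DF' : D' \is a polyOver F by rewrite polyOverZ.
have [Q [R [QF RF eM ltR]]] := monic_division mD' DF' MF.
rewrite sD' in ltR.
have eR : R.[t] = - Q.[t] * (lead_coef D)^-1 * D.[t].
  have /eqP := Mt; rewrite eM hornerD hornerM hornerZ addrC addr_eq0 => /eqP ->.
  by rewrite mulNr mulrA mulNr.
have [Rt|Rt] := eqVneq R.[t] 0; last first.
  have [|V VF eV] := IHn R RF Rt (ltn_trans ltR ltD).
    exact: leq_trans ltR szD.
  exists (V * (- Q) * (lead_coef D)^-1%:P).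
    by rewrite ?(rpredM, rpredN, polyOverC).
  by rewrite -eV eR !hornerM hornerN hornerC; ring.
(* Now [D'] divides M: either D is constant, or the cofactor Q is shorter than M and vanishes at t,
   against minimality. *)
have R0 := minM RF (ltn_trans ltR ltD) Rt.
move: eM; rewrite R0 addr0 => eM.
have [le1|gt1] := leqP (size D) 1.
  exists (lead_coef D)^-1%:P; first by rewrite polyOverC.
  have eD : D = (lead_coef D)%:P.
    by rewrite {1}[D]size1_polyC // lead_coefE; case: (size D) le1 => [|[]].
  by rewrite {2}eD !hornerC mulVf.
have Q0 : Q != 0.
  by apply: contraTneq monicM => Q0;
    rewrite eM Q0 mul0r monicE lead_coef0 eq_sym oner_neq0.
have ltQ : (size Q < size M)%N.
  rewrite eM size_Mmonic // sD' -subn1.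
  by move: (size Q) (size D) gt1 => a b gt1; rewrite -addnBA ?(ltnW gt1) //;
    lia.
have /eqP[] := Q0; apply: minM => //.
move: eR => /eqP; rewrite Rt eq_sym !mulf_eq0 (negPf Dt) orbF.
by rewrite invr_eq0 (negPf lD0) orbF oppr_eq0 => /eqP.
Qed.
End MinimalPolynomial.

Lemma polyOver_subset (S : subringClosed K) (l : seq K) (P : {poly K}) :
  {subset (P : seq K) <= l} -> {subset l <= S} -> P \is a polyOver S.
Proof. by move=> Pl lS; apply/allP=> x /Pl/lS. Qed.

Lemma minimal_polynomial (F : divringClosed K) t P :
    P \is a polyOver F -> P != 0 -> P.[t] = 0 ->
  exists M, [/\ M \is a polyOver F, M \is monic, M.[t] = 0 &
    forall Q, Q \is a polyOver F -> (size Q < size M)%N -> Q.[t] = 0 -> Q = 0].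
Proof.
move=> PF P0 Pt.
pose ann n := `[< exists Q, [/\ Q \is a polyOver F, Q != 0, Q.[t] = 0 &
  size Q = n] >].
have exn : exists n, ann n by exists (size P); apply/asboolP; exists P.
have [n /asboolP[Q [QF Q0 Qt sQ]] minn] := ex_minnP exn.
have lQ : (lead_coef Q)^-1 != 0 by rewrite invr_eq0 lead_coef_eq0.
exists ((lead_coef Q)^-1 *: Q); split.
- by rewrite polyOverZ // rpredV; apply/polyOverP.
- by rewrite monicE lead_coefZ mulVf // lead_coef_eq0.
- by rewrite hornerZ Qt mulr0.
- move=> T TF; rewrite size_scale // sQ => ltT Tt; apply/eqP/negP => /negP T0.
  have : ann (size T) by apply/asboolP; exists T.
  by move/minn; rewrite leqNgt ltT.
Qed.

(** An algebraic t is handled by its minimal polynomial. For a transcendental t, write t = a + p y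
    with a natural number a at which no denominator D vanishes: then D(t) is D(a) times some 1 + p
    Q(y), which is invertible in the new model. *)
Lemma has_models_adjoin (F : divringClosed K) (t : K) : has_models F ->
  exists F' : divringClosed K, [/\ has_models F', {subset F <= F'} & t \in F'].
Proof.
move=> HF; have [F' F'P] := divring_adjoin F t.
have FF' : {subset F <= F'}.
  move=> x xF; apply/F'P; exists x%:P, 1.
  by rewrite polyOverC xF rpred1 !hornerC oner_neq0 divr1.
have tF' : t \in F'.
  apply/F'P; exists 'X, 1.
  by rewrite polyOverX rpred1 hornerX hornerC oner_neq0 divr1.
exists F'; split=> //.
have hornerF' P : P \is a polyOver F -> P.[t] \in F'.
  by move=> PF; rewrite rpred_horner //; apply: polyOverS PF.
move=> l lF'.
case: (pselect (exists P, [/\ P \is a polyOver F, P != 0 & P.[t] = 0])).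
  case=> P [PF P0 Pt]; have [M [MF monicM Mt minM]] := minimal_polynomial PF
    P0 Pt.
  have /choice[f fP] : forall x, exists P, P \is a polyOver F /\
      (x \in l -> x = P.[t]).
    move=> x; case: (boolP (x \in l)) => [/lF'/F'P[N [D [NF DF D0 ->]]]|_].
      have [V VF eV] := adjoin_inverse MF monicM Mt minM DF D0.
      exists (N * V); rewrite rpredM // hornerM; split=> // _.
      by apply: (canLR (mulfK D0)); rewrite -mulrA eV mulr1.
    by exists 0; rewrite rpred0.
  pose l0 := (M : seq K) ++ flatten [seq (f x : seq K) | x <- l].
  have [|p [S [A [mod SF l0A]]]] := HF l0.
    move=> c; rewrite mem_cat => /orP[/(allP MF) //|].
    by case/flatten_mapP => x _; apply/allP; case: (fP x).
  have MA : M \is a polyOver A.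
    by apply: polyOver_subset l0A => c cM; rewrite mem_cat cM.
  have [|S' [A' [mod' S'P A'P]]] := model_adjoin_algebraic mod monicM MA Mt.
    by move=> Q QS; apply: minM; apply: polyOverS QS.
  exists p, S', A'; split=> // x.
    by move=> /S'P[Q QS ->]; apply: hornerF'; apply: polyOverS QS.
  move=> xl; have [_ /(_ xl) ex] := fP x; apply/A'P; exists (f x) => //.
  apply: polyOver_subset l0A => c cf; rewrite mem_cat; apply/orP; right.
  by apply/flatten_mapP; exists x.
move=> tr; have {tr} transc Q : Q \is a polyOver F -> Q.[t] = 0 -> Q = 0.
  by move=> QF Qt; apply/eqP/negP => /negP Q0; apply: tr; exists Q.
have /choice[N /choice[D NDP]] : forall x, exists N D, [/\ N \is a polyOver F,
    D \is a polyOver F, D.[t] != 0 & x \in l -> x = N.[t] / D.[t]].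
  move=> x; case: (boolP (x \in l)) => [/lF'/F'P[N [D [NF DF D0 e]]]|_].
    by exists N, D.
  by exists 0, 1; rewrite rpred0 rpred1 hornerC oner_neq0.
have D0 x : D x != 0.
  by have [_ _ h _] := NDP x; apply: contraNneq h => ->; rewrite horner0.
(* In characteristic 0 a nonzero polynomial cannot vanish at all natural numbers. *)
have [a aP] : exists a : nat, (\prod_(x <- l) D x).[a%:R] != 0.
  apply: contrapT => h.
  have prod0 : \prod_(x <- l) D x != 0 by rewrite prodf_seq_neq0;
    apply/allP=> x _ /=.
  pose rs : seq K := [seq j%:R | j <- iota 0 (size (\prod_(x <- l) D x))].
  have roots : all (root (\prod_(x <- l) D x)) rs.
    apply/allP=> _ /mapP[j _ ->]; apply/rootP/eqP/negP=> /negP aj.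
    by apply: h; exists j.
  have := max_poly_roots prod0 roots.
  rewrite size_map size_iota ltnn map_inj_uniq ?iota_uniq; last exact: natr_inj.
  by move=> /(_ isT).
have Da x : x \in l -> (D x).[a%:R] != 0.
  by move: aP; rewrite horner_prod prodf_seq_neq0 => /allP h /h.
(* The inverses of the D(a) are listed so that they lie in A. The prime p depends on this list, so y
   is defined only afterwards. *)
pose l0 := flatten [seq (D x).[a%:R]^-1 :: ((N x : seq K) ++ D x) | x <- l].
have [|p [S [A [mod SF l0A]]]] := HF l0.
  move=> c /flatten_mapP[x xl]; have [NF DF _ _] := NDP x.
  rewrite in_cons mem_cat => /or3P[/eqP->|/(allP NF)|/(allP DF)] //.
  by rewrite rpredV rpred_horner ?rpred_nat.
have p0 : p%:R != 0 :> K by rewrite natr_eq0 -lt0n prime_gt0 ?(model_prime mod).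
have pF : p%:R^-1 \in F by rewrite rpredV rpred_nat.
pose y := (t - a%:R) / p%:R.
have py : p%:R * y = t - a%:R by rewrite mulrC divfK.
(* A relation for y over S, composed with (X - a) / p, becomes one for t over F. *)
have transc_y P : P \is a polyOver S -> P.[y] = 0 -> P = 0.
  move=> PS Py; pose q := p%:R^-1 *: ('X - a%:R%:P) : {poly K}.
  have : P \Po q = 0.
    apply: transc.
      rewrite polyOver_comp ?polyOverZ ?polyOverXsubC ?rpred_nat //.
      exact: polyOverS PS.
    by rewrite horner_comp hornerZ hornerXsubC mulrC.
  move/eqP; rewrite comp_poly_eq0 ?size_scale ?size_XsubC ?invr_eq0 //.
  by move/eqP.
have [S' [A' [mod' S'P A'P]]] := model_adjoin_transcendental mod transc_y.
have den0 Q : Q \is a polyOver S -> 1 + p%:R * Q.[y] != 0.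
  by move=> /(one_add_p_neq0 mod transc_y); rewrite hornerD hornerC hornerZ.
exists p, S', A'; split=> // x.
  move=> /S'P[P [Q [PS QS e]]].
  have yF' : y \in F' by rewrite /y rpredM ?(FF' _ pF) // rpredB ?rpred_nat.
  have evF' R : R \is a polyOver S -> R.[y] \in F'.
    by move=> RS; rewrite rpred_horner //; apply: polyOverS RS => z /SF/FF'.
  rewrite -[x](mulfK (den0 Q QS)) e rpred_div ?evF' //.
  by rewrite rpredD ?rpredM ?rpred1 ?rpred_nat ?evF'.
move=> xl; have [_ _ Dt /(_ xl) ex] := NDP x.
have l0x c : c \in (D x).[a%:R]^-1 :: ((N x : seq K) ++ D x) -> c \in l0.
  by move=> cx; apply/flatten_mapP; exists x.
have NA : N x \is a polyOver A.
  apply: polyOver_subset l0A => c cN; apply: l0x.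
  by rewrite in_cons mem_cat cN orbT.
have DA : D x \is a polyOver A.
  apply: polyOver_subset l0A => c cD; apply: l0x.
  by rewrite in_cons mem_cat cD !orbT.
have iDA : (D x).[a%:R]^-1 \in A by apply/l0A/l0x; rewrite mem_head.
have AS := model_sub mod.
(* Division by X - a, with the quotient re-expressed in y through t = a + p y. *)
have taylor P : P \is a polyOver A -> exists2 U, U \is a polyOver S &
    P.[t] = P.[a%:R] + p%:R * y * U.[y].
  move=> PA; have PS : P \is a polyOver S by apply: polyOverS PA.
  have [|U [T [US _ eP ltT]]] := monic_division (monicXsubC a%:R) _ PS.
    by rewrite polyOverXsubC rpred_nat.
  exists (U \Po (a%:R%:P + p%:R *: 'X)).
    by rewrite polyOver_comp ?rpredD ?polyOverC ?polyOverZ ?polyOverX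
      ?rpred_nat.
  rewrite size_XsubC ltnS in ltT.
  rewrite horner_comp hornerD hornerC hornerZ hornerX py [a%:R + _]addrC subrK.
  rewrite {1 2}eP.
  rewrite [T]size1_polyC // !(hornerXsubC, hornerD, hornerM, hornerC).
  by rewrite subrr; ring.
have [[U US eN] [V VS eD]] := (taylor _ NA, taylor _ DA).
pose w := (D x).[a%:R]^-1; have wS : w \in S by apply: AS.
have Da0 := Da x xl.
pose Q := w *: ('X * V).
have NaS : (N x).[a%:R] \in S by rewrite rpred_horner ?rpred_nat ?(polyOverS
  AS).
have QS : Q \is a polyOver S by rewrite polyOverZ ?rpredM ?polyOverX.
have eDQ : (D x).[t] = (D x).[a%:R] * (1 + p%:R * Q.[y]).
  by rewrite eD hornerZ hornerM hornerX /w; field.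
have xE : x * (1 + p%:R * Q.[y]) = w * (N x).[t].
  rewrite {1}ex eDQ /w; move: (den0 Q QS) Da0.
  by move: (1 + _) (D x).[a%:R] => u v u0 v0; field; rewrite u0 v0.
(* Modulo p, x = N(t) / D(t) is congruent to N(a) / D(a), which lies in A. *)
apply/A'P; exists (w * (N x).[a%:R]).
  by rewrite rpredM // rpred_horner ?rpred_nat.
exists ((w * y * U.[y] - w * (N x).[a%:R] * Q.[y]) / (1 + p%:R * Q.[y])).
  apply/S'P; exists (w *: ('X * U) - (w * (N x).[a%:R]) *: Q), Q; split=> //.
    by rewrite rpredB ?polyOverZ ?rpredM ?polyOverX.
  rewrite mulfVK ?den0 // hornerD hornerN !hornerZ !hornerM !hornerX.
  by ring.
apply: (mulIf (den0 Q QS)); rewrite /= mulrBl xE mulrA mulfVK ?den0 // eN.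
by ring.
Qed.
End Tower.

(** * The Skolem-Mahler-Lech theorem *)

Lemma infinite_fiber (T : Type) (U : choiceType) (A : set T) (phi : T -> U)
    (rs : seq U) : (forall z, A z -> phi z \in rs) -> infinite_set A ->
  exists2 r, r \in rs & infinite_set [set z | A z /\ phi z = r].
Proof.
move=> Ars; apply: contra_notP => nex.
have : finite_set (\bigcup_(r in [set` rs]) [set z | A z /\ phi z = r]).
  apply: bigcup_finite => [|r rrs]; first exact: finite_seq.
  by apply: contrapT => inf; apply: nex; exists r.
by apply: sub_finite_set => z Az; exists (phi z) => //; apply: Ars.
Qed.

Section SkolemMahlerLech.
Variable K : fieldType.
Hypothesis natr_eq0 : forall n : nat, (n%:R == 0 :> K) = (n == 0%N).

Lemma padic_model_exists (l : seq K) : exists p (S A : subringClosed K),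
  padic_model p S A /\ {subset l <= A}.
Proof.
suff [F HF lF] : exists2 F : divringClosed K, has_models F & {subset l <= F}.
  by have [p [S [A [mod _ lA]]]] := HF l lF; exists p, S, A.
elim: l => [|t l [F HF lF]].
  by have [F HF] := prime_field_has_models natr_eq0; exists F.
have [F' [HF' FF' tF']] := has_models_adjoin natr_eq0 t HF.
by exists F' => // x; rewrite in_cons => /predU1P[->|/lF/FF'].
Qed.

Section Model.
Variables (p : nat) (S A : subringClosed K).
Hypothesis mod : padic_model p S A.

(** Pigeonhole: two powers c^i and c^j share a representative modulo p; multiplying their difference
    by c^(-i), which lies in S, gives d = j - i. *)
Lemma unit_power_cong1 c : c != 0 -> c \in A -> c^-1 \in A ->
  exists2 d, (0 < d)%N & exists2 b, b \in S & c ^+ d = 1 + p%:R * b.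
Proof.
move=> c0 cA icA; have [r rP] := model_fin mod.
have /choice[rep repP] : forall i, exists b, b \in r /\
    exists2 s, s \in S & c ^+ i - b = p%:R * s.
  by move=> i; have [|b br bs] := rP (c ^+ i); [exact: rpredX | exists b].
have /(uniqPn 0)[i [j [ltij]]] : ~~ uniq [seq rep i | i <- iota 0 (size r).+1].
  apply/negP => /uniq_leq_size => /(_ r)/=.
  rewrite size_map size_iota ltnn -[_ :: _]/([seq rep i | i <- iota 0 (size
    r).+1]).
  case/(_ _)/negP => // _ /mapP[i _ ->]; exact: (repP i).1.
rewrite size_map size_iota => ltj.
rewrite !(nth_map 0%N) ?size_iota ?(ltn_trans ltij) //
  !nth_iota ?(ltn_trans ltij) //.
rewrite !add0n => e.
have [[_ [s sS es]] [_ [s' sS' es']]] := (repP i, repP j).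
exists (j - i)%N; first by rewrite subn_gt0.
exists ((s' - s) * c^-1 ^+ i).
  by rewrite rpredM ?rpredB // (model_sub mod) ?rpredX.
have ej : c ^+ j = c ^+ i * c ^+ (j - i) by rewrite -exprD subnKC // ltnW.
rewrite mulrA mulrBr -es -es' e exprVn ej.
by have := expf_neq0 i c0 => ci0; field.
Qed.

Lemma cong1_expr b n : b \in S ->
  exists2 b', b' \in S & (1 + p%:R * b) ^+ n = 1 + p%:R * b'.
Proof.
move=> bS; exists (b * \sum_(i < n) (1 + p%:R * b) ^+ i).
  rewrite rpredM // rpred_sum // => i _.
  by rewrite rpredX // rpredD ?rpred1 // rpredM ?rpred_nat.
have /(canRL (subrK _)) -> := subrX1 (1 + p%:R * b) n; ring.
Qed.

Lemma common_power_cong1 (cs : seq K) :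
    (forall c, c \in cs -> [/\ c != 0, c \in A & c^-1 \in A]) ->
  exists2 d, (0 < d)%N & forall c, c \in cs ->
    exists2 b, b \in S & c ^+ d = 1 + p%:R * b.
Proof.
elim: cs => [|c cs IHcs] H; first by exists 1%N.
have [|d d0 dP] := IHcs; first by move=> a acs; apply: H;
  rewrite in_cons acs orbT.
have [c0 cA icA] := H c (mem_head _ _).
have [d' d0' [b bS eb]] := unit_power_cong1 c0 cA icA.
exists (d * d')%N; first by rewrite muln_gt0 d0.
move=> a; rewrite in_cons => /predU1P[->|/dP[b' bS' eb']].
  by rewrite mulnC exprM eb; apply: cong1_expr.
by rewrite exprM eb'; apply: cong1_expr.
Qed.
End Model.

Lemma infinite_residue_class (Z : set nat) d : (0 < d)%N -> infinite_set Z ->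
  exists r, infinite_set [set m | Z (r + d * m)%N].
Proof.
move=> d0 /(@infinite_fiber _ _ _ (fun n => n %% d)%N (iota 0 d)) [n _|r _ inf].
  by rewrite mem_iota ltn_pmod.
exists r => fin; apply: inf.
apply: sub_finite_set (finite_image (fun m => (r + d * m)%N) fin) => n [Zn <-].
have en : (n %% d + d * (n %/ d))%N = n by rewrite addnC mulnC -divn_eq.
by exists (n %/ d)%N; rewrite /= en.
Qed.

(** A common d makes the d-th powers of all bases congruent to 1 modulo p, and some class r modulo d
    contains infinitely many zeros; along r + d n, with the r-th powers absorbed in the
    coefficients, Hansel's estimate applies. *)
Lemma skolem_mahler_lech (s : seq (K * K)) : (forall x, x \in s -> x.2 != 0) ->
    infinite_set [set n : nat | \sum_(x <- s) x.1 * x.2 ^+ n = 0] ->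
  exists r d, (0 < d)%N /\
    forall n, \sum_(x <- s) x.1 * x.2 ^+ (r + d * n) = 0.
Proof.
move=> s0 inf.
have [p [S [A [mod lA]]]] := padic_model_exists
  (unzip1 s ++ unzip2 s ++ [seq x.2^-1 | x <- s]).
have sA x : x \in s -> [/\ x.1 \in A, x.2 \in A & x.2^-1 \in A].
  by move=> xs; split; apply: lA; rewrite !mem_cat (map_f _ xs) ?orbT.
have [|d d0 dP] := common_power_cong1 mod (cs := unzip2 s).
  by move=> _ /mapP[x xs ->]; have [_ ? ?] := sA x xs; split=> //; apply: s0.
have /choice[b bP] : forall c, exists b, c \in unzip2 s ->
    b \in S /\ c ^+ d = 1 + p%:R * b.
  move=> c; case: (boolP (c \in unzip2 s)) => [/dP[b ? ?]|_]; last by exists 0.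
  by exists b.
have [r infr] := infinite_residue_class d0 inf.
exists r, d; split=> //.
pose s' := [seq (x.1 * x.2 ^+ r, b x.2) | x <- s].
have es' n : \sum_(x <- s) x.1 * x.2 ^+ (r + d * n) =
    \sum_(x <- s') x.1 * (1 + p%:R * x.2) ^+ n.
  rewrite big_map; apply: eq_big_seq => x xs /=.
  have [_ <-] := bP x.2 (map_f _ xs).
  by rewrite exprD exprM mulrA.
move=> n; rewrite es'; apply: (exp_sum_zero_of_model natr_eq0 mod).
  move=> _ /mapP[x xs ->] /=; have [? ? _] := sA x xs.
  split; last by have [] := bP x.2 (map_f _ xs).
  by rewrite rpredM ?rpredX ?(model_sub mod).
by apply: sub_infinite_set infr => m /=; rewrite es'.
Qed.
End SkolemMahlerLech.

(** * Exponential polynomials *)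

Lemma infinite_set_int (Z : set int) : infinite_set Z ->
  infinite_set [set n : nat | Z n%:Z] \/
  infinite_set [set n : nat | Z (- n%:Z)].
Proof.
move=> inf; apply: contrapT => /not_orP[/contrapT fp /contrapT fn]; apply: inf.
have : finite_set ((fun n : nat => n%:Z) @` [set n : nat | Z n%:Z] `|`
    (fun n : nat => - n%:Z) @` [set n : nat | Z (- n%:Z)]).
  by rewrite finite_setU; split; apply: finite_image.
apply: sub_finite_set => m Zm; case: (intP m) Zm => [|n|n] Zm.
- by left; exists 0%N.
- by left; exists n.+1.
- by right; exists n.+1.
Qed.

Section Interpolation.
Variable K : fieldType.

Lemma interpolation (phi : K -> K) (us : seq K) :
  exists P : {poly K}, forall u, u \in us -> P.[u] = phi u.
Proof.
elim: us => [|u us [P PE]]; first by exists 0.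
have [uus|uNus] := boolP (u \in us).
  by exists P => v; rewrite in_cons => /predU1P[->|]; apply: PE.
pose W := \prod_(v <- us) ('X - v%:P).
have Wu : W.[u] != 0 by rewrite -[_ == 0]/(root W u) root_prod_XsubC.
exists (P + ((phi u - P.[u]) / W.[u]) *: W) => v.
rewrite in_cons hornerD hornerZ => /predU1P[->|vus].
  by rewrite divfK // addrC subrK.
have /rootP -> : root W v by rewrite root_prod_XsubC.
by rewrite mulr0 addr0 PE.
Qed.

(** On the finitely many bases phi agrees with a polynomial, so the sum is a combination of power
    sums. This expresses, without collecting terms, that the coefficients over each base add up to
    0. *)
Lemma sum_eq0_of_power_sums (s : seq (K * K)) (phi : K -> K) :
    (forall n, \sum_(x <- s) x.1 * x.2 ^+ n = 0) ->
  \sum_(x <- s) x.1 * phi x.2 = 0.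
Proof.
move=> s0; have [P PE] := interpolation phi (unzip2 s).
transitivity (\sum_(i < size P) P`_i * \sum_(x <- s) x.1 * x.2 ^+ i).
  under [RHS]eq_bigr do rewrite mulr_sumr.
  rewrite exchange_big; apply: eq_big_seq => x xs /=.
  rewrite -PE ?map_f // horner_coef mulr_sumr; apply: eq_bigr => i _; ring.
by rewrite big1 // => i _; rewrite s0 mulr0.
Qed.

End Interpolation.

(** * Closure properties of exponential polynomials and divisibility by binomials *)

Section ExpPoly.
Variables (K : fieldType) (e : K -> K).
Hypothesis exp_e : exponential e.

Lemma expo_neq0 x : e x != 0. Proof. exact: exp_e.1. Qed.
Lemma expoD x y : e (x + y) = e x * e y. Proof. exact: exp_e.2. Qed.

Lemma expo0 : e 0 = 1.
Proof. by apply: (mulfI (expo_neq0 0)); rewrite -expoD addr0 mulr1. Qed.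

Lemma expoN x : e (- x) = (e x)^-1.
Proof.
by apply: (mulfI (expo_neq0 x)); rewrite -expoD subrr expo0 divff ?expo_neq0.
Qed.

Lemma expoB x y : e (x - y) = e x / e y.
Proof. by rewrite expoD expoN. Qed.

Lemma expo_nat n x : e (n%:R * x) = e x ^+ n.
Proof.
elim: n => [|n IHn]; first by rewrite mul0r expo0.
by rewrite mulrSr mulrDl mul1r expoD IHn exprSr.
Qed.

Lemma exp_poly_mono c mu : exp_poly e (fun z => c * e (mu * z)).
Proof. by exists [:: (c, mu)] => //; apply/funext => z;
  rewrite /exp_sum big_seq1. Qed.

Lemma exp_poly_sum (I : eqType) (r : seq I) (F : I -> K -> K) :
  (forall i, i \in r -> exp_poly e (F i)) ->
  exp_poly e (fun z => \sum_(i <- r) F i z).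
Proof.
elim: r => [|i r IHr] Fr.
  by exists [::] => //; apply/funext => z; rewrite /exp_sum !big_nil.
have [s _ es] := Fr i (mem_head _ _).
have [|s' _ es'] := IHr; first by move=> j jr; apply: Fr;
  rewrite in_cons jr orbT.
exists (s ++ s') => //; apply/funext => z.
have := congr1 (@^~ z) es'; rewrite /= /exp_sum => h.
by rewrite /exp_sum big_cat big_cons -h -es.
Qed.

Lemma exp_poly_mul f g : exp_poly e f -> exp_poly e g -> exp_poly e (f \* g).
Proof.
move=> [s _ <-] [s' _ <-].
have -> : exp_sum e s \* exp_sum e s' =
    fun z => \sum_(p <- s) (fun z =>
      \sum_(q <- s') (p.1 * q.1) * e ((p.2 + q.2) * z)) z.
  apply/funext => z /=; rewrite /exp_sum mulr_suml; apply: eq_bigr => p _.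
  by rewrite mulr_sumr; apply: eq_bigr => q _; rewrite mulrDl expoD; ring.
by apply: exp_poly_sum => p _; apply: exp_poly_sum => q _; apply: exp_poly_mono.
Qed.

Lemma exp_poly_horner P b : exp_poly e (fun z => P.[e (b * z)]).
Proof.
have -> : (fun z => P.[e (b * z)]) =
    fun z => \sum_(i <- index_enum 'I_(size P)) P`_i * e ((i%:R * b) * z).
  apply/funext => z; rewrite horner_coef; apply: eq_bigr => i _.
  by rewrite -mulrA expo_nat.
by apply: exp_poly_sum => i _; apply: exp_poly_mono.
Qed.

Lemma divides_sum h (I : eqType) (r : seq I) (F : I -> K -> K) :
    (forall i, i \in r -> divides_exp_poly e h (F i)) ->
  divides_exp_poly e h (fun z => \sum_(i <- r) F i z).
Proof.
move=> Fr; have /choice[q qP] : forall i, exists q, i \in r ->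
    exp_poly e q /\ F i = h \* q.
  move=> i; case: (boolP (i \in r)) => [/Fr[q ? ?]|_]; last by exists h.
  by exists q.
exists (fun z => \sum_(i <- r) q i z).
  by apply: exp_poly_sum => i /qP[].
apply/funext => z /=; rewrite mulr_sumr; apply: eq_big_seq => i /qP[_].
by move/(congr1 (@^~ z)).
Qed.

Lemma divides_scale h c f :
  divides_exp_poly e h f -> divides_exp_poly e h (fun z => c * f z).
Proof.
case=> q qe ->; exists ((fun=> c) \* q).
  apply: exp_poly_mul qe; have -> : (fun=> c) = fun z => c * e (0 * z).
    by apply/funext => z; rewrite mul0r expo0 mulr1.
  exact: exp_poly_mono.
by apply/funext => z /=; ring.
Qed.

Section Binomial.
Variables b z1 : K.
Let h z := e (b * z) - e (b * z1).

(** With E = e(b (z - z1)) the difference is e(mu (z - z1)) (E^n - 1), and E - 1 equals h(z) / e(b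
    z1). *)
Lemma binomial_divides_nat mu n : divides_exp_poly e h
  (fun z => e ((mu + n%:R * b) * (z - z1)) - e (mu * (z - z1))).
Proof.
exists (fun z => \sum_(i <- index_enum 'I_n)
    (e (b * z1))^-1 * e (- (mu + i%:R * b) * z1) * e ((mu + i%:R * b) * z)).
  by apply: exp_poly_sum => i _; apply: exp_poly_mono.
apply/funext => z /=; rewrite /h mulrDl expoD -mulrA expo_nat.
have -> : e (b * z) = e (b * (z - z1)) * e (b * z1).
  by rewrite -expoD -mulrDr subrK.
have /= := subrX1 (e (b * (z - z1))) n => hX.
rewrite -{2}[e (mu * _)]mulr1 -mulrBr hX.
rewrite -{2}[e (b * z1)]mul1r -mulrBl mulrCA -mulrA; congr (_ * _).
rewrite !mulr_sumr; apply: eq_bigr => i _.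
have -> : (e (b * z1))^-1 * e (- (mu + i%:R * b) * z1) *
    e ((mu + i%:R * b) * z) =
    (e (b * z1))^-1 * (e (mu * (z - z1)) * e (b * (z - z1)) ^+ i).
  rewrite -expo_nat -!mulrA -!expoD; congr (_ * e _); ring.
by rewrite mulVKf ?expo_neq0.
Qed.

Lemma binomial_divides_int mu (k : int) : divides_exp_poly e h
  (fun z => e ((mu + k%:~R * b) * (z - z1)) - e (mu * (z - z1))).
Proof.
case: k => n; first by rewrite -pmulrn; apply: binomial_divides_nat.
rewrite NegzE mulrNz -pmulrn mulNr.
(* For k = -(n + 1) the two frequencies exchange roles, at the cost of a sign. *)
have := divides_scale (-1) (binomial_divides_nat (mu - n.+1%:R * b) n.+1).
congr (divides_exp_poly e h _); apply/funext => z.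
by rewrite subrK mulN1r opprB.
Qed.

(* The frequencies of s are grouped by the value of e at mu * w / b: inside a
   group they differ by integer multiples of b, so all its terms agree modulo h,
   and the coefficients of each group sum to 0 by the vanishing hypothesis. *)
Lemma binomial_divides (w : K) (s : seq (K * K)) : b != 0 -> w != 0 ->
    exp_kernel e = range (fun k : int => w *~ k) ->
    (forall n : nat, exp_sum e s (z1 + n%:R * (w / b)) = 0) ->
  divides_exp_poly e h (exp_sum e s).
Proof.
move=> b0 w0 ker s0; pose chi mu := e (mu * (w / b)).
(* nu picks one frequency for each value of [chi], as the representative of its group. *)
have /choice[nu nuP] : forall g, exists nu, (exists mu, chi mu = g) ->
  chi nu = g.
  move=> g; case: (pselect (exists mu, chi mu = g)) => [[mu <-]|nex].
    by exists mu.
  by exists 0 => /nex.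
(* The subtracted terms add up to 0 by [sum_eq0_of_power_sums]: the power sums in the [chi] values
   are the values of the sum at z1 + n w / b. *)
have eqF : exp_sum e s = fun z => \sum_(x <- s) x.1 * e (x.2 * z1) *
    (e (x.2 * (z - z1)) - e (nu (chi x.2) * (z - z1))).
  apply/funext => z.
  pose s' := [seq (x.1 * e (x.2 * z1), chi x.2) | x <- s].
  have /(_ s' (fun g => e (nu g * (z - z1)))) := @sum_eq0_of_power_sums K.
  rewrite !big_map /= => s'0; under [RHS]eq_bigr do rewrite mulrBr.
  rewrite sumrB s'0 ?subr0 => [|n].
    apply: eq_bigr => x _; rewrite -mulrA -expoD -mulrDr.
    by rewrite [z1 + _]addrC subrK.
  rewrite -[RHS](s0 n) big_map; apply: eq_bigr => x _ /=.
  by rewrite mulrDr expoD mulrA /chi -expo_nat; congr (_ * e _); ring.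
rewrite eqF; apply: divides_sum => x _; apply: divides_scale.
have : exp_kernel e ((x.2 - nu (chi x.2)) * (w / b)).
  rewrite /exp_kernel /= mulrBl expoB -[e (x.2 * _)]/(chi x.2).
  rewrite -[e (nu _ * _)]/(chi (nu (chi x.2))) nuP; last by exists x.2.
  by rewrite divff // expo_neq0.
rewrite ker => -[k _ /= ek].
have /eqP : x.2 - nu (chi x.2) = k%:~R * b.
  apply: (mulIf w0); rewrite mulrAC; apply: (canRL (divfK b0)).
  by rewrite -mulrA -ek mulrzl.
rewrite subr_eq addrC => /eqP {1}->; exact: binomial_divides_int.
Qed.
End Binomial.
End ExpPoly.

(** * Normal form of simple exponential polynomials *)

Section SimpleExpPoly.
Variables (K : fieldType) (e : K -> K).
Hypothesis natr_eq0 : forall n : nat, (n%:R == 0 :> K) = (n == 0%N).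
Hypothesis exp_e : exponential e.

(** M clears denominators and the shift N removes negative values, so that the results can serve as
    exponents in a polynomial. *)
Lemma common_denominator (l : seq rat) : exists M N : nat, M%:R != 0 :> K /\
  forall q, q \in l -> exists n : nat, ratr q * M%:R + N%:R = n%:R :> K.
Proof.
elim: l => [|q l [M [N [M0 MN]]]]; first by exists 1%N, 0%N; rewrite oner_neq0.
have [d [d0 ed]] : exists d : nat, d%:R != 0 :> K /\
    ratr q * d%:R = (numq q)%:~R :> K.
  exists `|denq q|%N; rewrite natr_eq0 absz_eq0 denq_neq0; split=> //.
  by rewrite /ratr pmulrn gez0_abs ?denq_ge0 // divfK // intr_eq0_char0 //
    denq_neq0.
(* With this shift q gives M (num q + |num q|) + N d, a natural number. *)
exists (M * d)%N, (N * d + `|numq q| * M)%N; split;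
  first by rewrite natrM mulf_neq0.
move=> q'; rewrite in_cons => /predU1P[->|/MN[n en]]; last first.
  exists (n * d + `|numq q| * M)%N.
  by rewrite !natrD !natrM -en; ring.
have : 0 <= numq q + `|numq q|%N%:Z by lia.
case E : (numq q + _) => [a|//] _; exists (a * M + N * d)%N.
have ea : a%:R = (numq q)%:~R + `|numq q|%N%:R :> K.
  by rewrite [a%:R]pmulrn -E rmorphD.
by rewrite !natrD !natrM ea -ed; ring.
Qed.

(** All frequencies are rational multiples of one b0. With b = b0 / M they become (n - N) b, and mu
    = - N b carries the common shift. *)
Lemma simple_exp_polyE f : simple_exp_poly e f ->
  exists (b mu : K) (P : {poly K}), b != 0 /\ f = fun z => e (mu * z) * P.[e (b * z)].
Proof.
case=> _ [B [sB free supE]];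
  case: B sB free supE => [|b0 [|//]] //= _ free supE.
have b0n : b0 != 0.
  apply/eqP => b00; have := free (fun=> 1); rewrite big_ord1 b00 mulr0.
  by move=> /(_ erefl ord0)/eqP; rewrite oner_eq0.
(* Membership of 0 in the support yields a reduced writing s of f. *)
have [s [red fE _]] : supp e f 0.
  rewrite supE; exists (fun=> 0).
  by rewrite big1 // => i _; rewrite /ratr /= mul0r mul0r.
have sup mu : mu \in unzip2 s -> exists q, mu = ratr q * b0.
  move=> smu; suff : supp e f mu by rewrite supE => -[c ->]; exists (c ord0);
    rewrite big_ord1.
  exists s; split=> //; have ltm : (index mu (unzip2 s) < size (unzip2 s))%N.
    by rewrite index_mem.
  exists (fun i : 'I_(size (unzip2 s)) => (i == Ordinal ltm)%:R).
  rewrite (bigD1 (Ordinal ltm)) //=.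
  rewrite eqxx /ratr /= nth_index // big1 ?addr0 ?divr1 ?mul1r // =>
    i /negPf ->.
  by rewrite /= !mul0r.
have /choice[q qP] : forall mu, exists q, mu \in unzip2 s -> mu = ratr q * b0.
  move=> mu; case: (boolP (mu \in unzip2 s)) => [/sup[q ?]|_]; last by exists 0.
  by exists q.
have [M [N [M0 MN]]] := common_denominator [seq q mu | mu <- unzip2 s].
have /choice[n nP] : forall mu, exists n : nat, mu \in unzip2 s ->
    ratr (q mu) * M%:R + N%:R = n%:R :> K.
  move=> mu; case: (boolP (mu \in unzip2 s)) => [smu|_]; last by exists 0%N.
  by have [n en] := MN _ (map_f q smu); exists n.
pose b := b0 / M%:R.
exists b, (- (N%:R * b)), (\sum_(x <- s) x.1 *: 'X^(n x.2)); split.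
  by rewrite mulf_neq0 ?invr_eq0.
apply/funext => z; rewrite fE /exp_sum horner_sum mulr_sumr.
apply: eq_big_seq => x xs; rewrite hornerZ hornerXn -(expo_nat exp_e) mulrCA.
rewrite -(expoD exp_e); congr (_ * e _).
have sx := map_f snd xs; rewrite {1}(qP _ sx) -(nP _ sx) /b.
by field.
Qed.
End SimpleExpPoly.

(** * Construction of the common divisor *)

(** A unit of the ring has no zeros, so asking for infinitely many zeros of h excludes trivial
    divisors. *)
Theorem theorem3p3 (K : closedFieldType) (e : K -> K) (f g : K -> K)
  (charK : [pchar K] =i pred0)
  (exp_e : exponential e)
  (per_e : standard_periods e)
  (surj_e : surjective_on_units e)
  (simple_f : simple_exp_poly e f)
  (exp_g : exp_poly e g)
  (common : infinite_set [set z : K | f z = 0 /\ g z = 0]) :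
  exists h : K -> K,
    [/\ exp_poly e h,
        infinite_set [set z : K | h z = 0],
        divides_exp_poly e h f &
        divides_exp_poly e h g].
Proof.
have natr_eq0 : forall n : nat, (n%:R == 0 :> K) = (n == 0%N).
  exact/pcharf0P.
have [b [mu [P [b0 fE]]]] := simple_exp_polyE natr_eq0 exp_e simple_f.
(* If P = 0 then f is the zero function and g divides both. *)
have [P0|P0] := eqVneq P 0.
  have const c : exp_poly e (fun=> c).
    have -> : (fun=> c) = fun z => c * e (0 * z).
      by apply/funext => z; rewrite mul0r (expo0 exp_e) mulr1.
    exact: exp_poly_mono.
  exists g; split=> //.
  - by apply: sub_infinite_set common => z [].
  - exists (fun=> 0) => //; apply/funext => z.
    by rewrite fE P0 horner0 /= !mulr0.
  - by exists (fun=> 1) => //; apply/funext => z /=; rewrite mulr1.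
have [rs Prs] := closed_field_poly_normal P.
(* As e never vanishes, z |-> e(b z) sends common zeros to roots of P; one root r is hit infinitely
   often. *)
have [|r _ infr] := @infinite_fiber _ _ _ (fun z => e (b * z)) rs _ common.
  move=> z [/eqP]; rewrite fE mulf_eq0 (negPf (expo_neq0 exp_e _)) /= Prs
    hornerZ.
  rewrite mulf_eq0 lead_coef_eq0 (negPf P0) /= -[_ == 0]/(root _ _).
  by rewrite root_prod_XsubC.
have [z0 [[fz0 gz0] rz0]] := infinite_setN0 infr.
have [infker [w0 kerE0]] := per_e.
have [s _ gE] := exp_g.
have zE z : e (b * z) = r -> exists k : int, z = z0 + k%:~R * (w0 / b).
  move=> ez; have : exp_kernel e (b * (z - z0)).
    by rewrite /exp_kernel /= mulrBr (expoB exp_e) ez rz0 divff //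
      -rz0 expo_neq0.
  rewrite kerE0 => -[k _ /= ek]; exists k.
  by rewrite mulrA mulrzl ek mulrAC divff // mul1r addrC subrK.
have infk : infinite_set [set k : int | g (z0 + k%:~R * (w0 / b)) = 0].
  move=> fin; apply: infr.
  have := finite_image (fun k : int => z0 + k%:~R * (w0 / b)) fin.
  apply: sub_finite_set => z [[_ gz] /zE[k ek]].
  by exists k; rewrite /= -ek.
(* Skolem-Mahler-Lech takes natural indices; if the infinitely many k lie on the negative side, the
   generator changes sign. *)
have [w kerE infw] : exists2 w, exp_kernel e = range (fun k : int => w *~ k) &
    infinite_set [set n : nat | g (z0 + n%:R * (w / b)) = 0].
  case: (infinite_set_int infk) => inf; first by exists w0.
  exists (- w0).
    rewrite kerE0; apply/seteqP; split=> _ [k _ <-]; exists (- k) => //.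
    + by rewrite mulrNz mulNrz opprK.
    + by rewrite mulrNz mulNrz.
  apply: sub_infinite_set inf => n /=.
  by rewrite mulrNz -pmulrn !mulNr mulrN.
have w_neq0 : w != 0.
  apply/eqP => w00; apply: infker; rewrite kerE w00.
  apply: sub_finite_set (finite_set1 0) => _ [k _ <-].
  by rewrite /= mul0rz.
pose s' := [seq (x.1 * e (x.2 * z0), e (x.2 * (w / b))) | x <- s].
have gAP n : g (z0 + n%:R * (w / b)) = \sum_(x <- s') x.1 * x.2 ^+ n.
  rewrite -gE big_map; apply: eq_bigr => x _ /=.
  rewrite -(expo_nat exp_e) -mulrA -(expoD exp_e); congr (_ * e _); ring.
have [||n0 [d [d_gt0 s'0]]] := @skolem_mahler_lech K natr_eq0 s'.
- by move=> _ /mapP[x _ ->] /=; apply: expo_neq0.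
- by apply: sub_infinite_set infw => n /=; rewrite gAP.
have d0 : d%:R != 0 :> K by rewrite natr_eq0 -lt0n.
(* Dividing b by d makes the step w / c equal to d w / b, so the points z1 + n w / c run through the
   progression n0 + d n. *)
pose z1 := z0 + n0%:R * (w / b); pose c := b / d%:R.
have c0 : c != 0 by rewrite mulf_neq0 ?invr_eq0.
have step n : z1 + n%:R * (w / c) = z0 + (n0 + d * n)%:R * (w / b).
  by rewrite natrD natrM /z1 /c; field; rewrite b0 d0.
have w1 : e w = 1 by have : exp_kernel e w by rewrite kerE; exists 1.
exists (fun z => e (c * z) - e (c * z1)); split.
- exists [:: (1, c); (- e (c * z1), 0)] => //; apply/funext => z.
  by rewrite /exp_sum big_cons big_seq1 /= mul1r mul0r (expo0 exp_e) mulr1.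
- move=> fin; apply: infinite_nat; pose F n := z1 + n%:R * (w / c).
  have injF : injective F.
    move=> m n /addrI/mulIf => /(_ (mulf_neq0 w_neq0 _)).
    by rewrite invr_eq0 => /(_ c0)/(natr_inj natr_eq0).
  apply: sub_finite_set (finite_preimage (in2W injF) fin) => n _ /=.
  have -> : c * F n = n%:R * w + c * z1 by rewrite /F; field.
  by rewrite (expoD exp_e) (expo_nat exp_e) w1 expr1n mul1r subrr.
(* Since e(c z1)^d = e(b z0) is a root of P, X - e(c z1) divides P(X^d), whose value at e(c z) is
   P(e(b z)). *)
- have : root (P \Po 'X^d) (e (c * z1)).
    rewrite /root horner_comp hornerXn -(expo_nat exp_e).
    have -> : d%:R * (c * z1) = b * z0 + n0%:R * w.
      by rewrite /z1 /c; field; rewrite b0 d0.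
    rewrite (expoD exp_e) (expo_nat exp_e) w1 expr1n mulr1.
    move/eqP: fz0; rewrite fE mulf_eq0 (negPf (expo_neq0 exp_e _)).
    by [].
  case/factor_theorem => Q eQ.
  exists ((fun z => 1 * e (mu * z)) \* (fun z => Q.[e (c * z)])).
    apply: (exp_poly_mul exp_e);
      [exact: exp_poly_mono | exact: exp_poly_horner].
  apply/funext => z /=; rewrite fE.
  have -> : P.[e (b * z)] = (P \Po 'X^d).[e (c * z)].
    rewrite horner_comp hornerXn -(expo_nat exp_e); congr P.[e _].
    by rewrite /c; field.
  by rewrite eQ hornerM hornerXsubC; ring.
- rewrite -gE; apply: (binomial_divides exp_e c0 w_neq0 kerE) => n.
  by rewrite gE step gAP.
Qed.
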